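(* Let $k\geq 2$ be an integer and, for $n\geq 0$, let $b_{k,n}$ denote the number of odd-up words over $k$ of length $n$. Let $B_k(x)=\sum_{n\geq 0}b_{k,n}x^n$. Then \[B_k(x)=\frac{(x+1)^{\lfloor (k+1)/2\rfloor}}{x+2-(x+1)^{\lfloor (k+2)/2\rfloor}}.\]
   Context: For an integer $k\geq 2$, let $[k]=\{1,\ldots,k\}$. A word over $k$ of length $n$ is an element $w_1\cdots w_n\in[k]^n$ (for $n=0$ there is exactly one word, the empty word). A word $w_1\cdots w_n\in[k]^n$ is odd-up if for every $i\in[n-1]$, whenever $w_i$ is odd, $w_{i+1}>w_i$. *)

(* Defs.v *)
From HB Require Import structures.
From mathcomp Require Import all_boot all_order all_algebra.
From mathcomp Require Import boolp.

Set Implicit Arguments.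
Unset Strict Implicit.
Unset Printing Implicit Defensive.

Import GRing.Theory.
Local Open Scope ring_scope.

(* Formal power series over R. The equality and choice structures are the
   classical ones; f = g holds iff all coefficients agree, by fpsP. *)
Record fps (R : Type) := Fps { fcoef : nat -> R }.

HB.instance Definition _ (R : Type) := gen_eqMixin (fps R).
HB.instance Definition _ (R : Type) := gen_choiceMixin (fps R).

Lemma fpsP (R : Type) (f g : fps R) : (forall n, fcoef f n = fcoef g n) <-> f = g.
Proof.
split=> [|->//]; case: f g => [f] [g] /= fg; congr Fps; exact: funext.
Qed.

Section FpsRing.
Variable R : comNzRingType.
Implicit Types f g h : fps R.

Definition fps0 : fps R := Fps (fun=> 0).
Definition fps1 : fps R := Fps (fun n => (n == 0%N)%:R).
Definition fpsN f := Fps (fun n => - fcoef f n).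
Definition fpsD f g := Fps (fun n => fcoef f n + fcoef g n).
Definition fpsM f g := Fps (fun n => \sum_(i < n.+1) fcoef f i * fcoef g (n - i)).

Definition fps_trunc (m : nat) f : {poly R} := \poly_(i < m) fcoef f i.

Lemma fpsDA : associative fpsD.
Proof. by move=> f g h; apply/fpsP => n; apply: addrA. Qed.
Lemma fpsDC : commutative fpsD.
Proof. by move=> f g; apply/fpsP => n; apply: addrC. Qed.
Lemma fps0D : left_id fps0 fpsD.
Proof. by move=> f; apply/fpsP => n; apply: add0r. Qed.
Lemma fpsND : left_inverse fps0 fpsN fpsD.
Proof. by move=> f; apply/fpsP => n; apply: addNr. Qed.

HB.instance Definition _ := GRing.isZmodule.Build (fps R) fpsDA fpsDC fps0D fpsND.

Lemma coef_fpsM_poly f g (p q : {poly R}) n :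
    (forall i, (i <= n)%N -> p`_i = fcoef f i) ->
    (forall i, (i <= n)%N -> q`_i = fcoef g i) ->
  fcoef (fpsM f g) n = (p * q)`_n.
Proof.
move=> pf qg; rewrite coefM /=; apply: eq_bigr => i _.
by rewrite pf ?qg ?leq_subr // -ltnS.
Qed.

Lemma coef_fps_trunc m f i : (i < m)%N -> (fps_trunc m f)`_i = fcoef f i.
Proof. by move=> im; rewrite coef_poly im. Qed.

Lemma coef_fpsM f g n m : (n < m)%N ->
  fcoef (fpsM f g) n = (fps_trunc m f * fps_trunc m g)`_n.
Proof.
by move=> nm; apply: coef_fpsM_poly => i le_in;
  rewrite coef_fps_trunc // (leq_ltn_trans le_in nm).
Qed.

Lemma fpsMA : associative fpsM.
Proof.
move=> f g h; apply/fpsP => n.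
rewrite (@coef_fpsM_poly _ _ (fps_trunc n.+1 f)
           (fps_trunc n.+1 g * fps_trunc n.+1 h)); first last.
- by move=> i le_in; rewrite -coef_fpsM.
- by move=> i le_in; rewrite coef_fps_trunc.
rewrite (@coef_fpsM_poly _ _ (fps_trunc n.+1 f * fps_trunc n.+1 g)
           (fps_trunc n.+1 h)) ?mulrA //.
- by move=> i le_in; rewrite -coef_fpsM.
- by move=> i le_in; rewrite coef_fps_trunc.
Qed.

Lemma fpsMC : commutative fpsM.
Proof. by move=> f g; apply/fpsP => n; rewrite !(coef_fpsM _ _ (ltnSn n)) mulrC. Qed.

Lemma fps1M : left_id fps1 fpsM.
Proof.
move=> f; apply/fpsP => n /=.
by rewrite big_ord_recl /= subn0 mul1r big1 ?addr0 // => i _; rewrite mul0r.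
Qed.

Lemma fpsMDl : left_distributive fpsM fpsD.
Proof.
move=> f g h; apply/fpsP => n /=.
by rewrite -big_split; apply: eq_bigr => i _; rewrite mulrDl.
Qed.

Lemma fps1_neq0 : fps1 != fps0.
Proof. by apply/eqP => /fpsP /(_ 0%N) /eqP; rewrite /= oner_eq0. Qed.

HB.instance Definition _ :=
  GRing.Zmodule_isComNzRing.Build (fps R) fpsMA fpsMC fps1M fpsMDl fps1_neq0.

Definition fpsX : fps R := Fps (fun n => (n == 1%N)%:R).

End FpsRing.

Section FpsUnit.
Variable R : comUnitRingType.
Implicit Types f g : fps R.

Definition fps_unit : {pred fps R} := fun f => fcoef f 0 \is a GRing.unit.

(* The first n coefficients of the inverse g of f, obtained by solving
   [sum_(i <= m) f_(m - i) * g_i = (m == 0)] for g_m, successively for m < n. *)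
Fixpoint fps_inv_seq f (n : nat) : seq R :=
  if n is m.+1 then
    let s := fps_inv_seq f m in
    rcons s ((fcoef f 0)^-1 * ((m == 0%N)%:R - \sum_(i < m) fcoef f (m - i) * s`_i))
  else [::].

(* A series without an invertible constant coefficient is its own inverse, as
   the unit ring interface requires; f / g is the genuine quotient whenever the
   constant coefficient of g is a unit. *)
Definition fps_inv f : fps R :=
  if f \in fps_unit then Fps (fun n => (fps_inv_seq f n.+1)`_n) else f.

Lemma size_fps_inv_seq f n : size (fps_inv_seq f n) = n.
Proof. by elim: n => //= n IHn; rewrite size_rcons IHn. Qed.

Lemma nth_fps_inv_seq f n i : (i < n)%N ->
  (fps_inv_seq f n)`_i = (fps_inv_seq f i.+1)`_i.
Proof.
elim: n => // n IHn; rewrite ltnS leq_eqVlt => /predU1P[->//|lt_in].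
by rewrite [fps_inv_seq f n.+1]/= nth_rcons size_fps_inv_seq lt_in IHn.
Qed.

Lemma fps_mulVf : {in fps_unit, left_inverse 1 fps_inv *%R}.
Proof.
move=> f fU; apply/fpsP => n; rewrite /fps_inv fU.
rewrite [LHS]/(fcoef (fpsM _ _) n) /fpsM /fcoef -/(@fcoef R).
rewrite big_ord_recr /= subnn nth_rcons size_fps_inv_seq ltnn eqxx.
rewrite mulrC mulrA divrr // mul1r addrC -addrA [X in _ + X](_ : _ = 0) ?addr0 //.
apply/eqP; rewrite addrC subr_eq0; apply/eqP/eq_bigr => i _.
by rewrite mulrC -[rcons _ _]/(fps_inv_seq f i.+1) -(@nth_fps_inv_seq f n i).
Qed.

Lemma fps_unitPl f g : g * f = 1 -> f \in fps_unit.
Proof.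
move/fpsP/(_ 0%N); rewrite [LHS]/(fcoef (fpsM _ _) 0) /= big_ord1 subn0 /= => gf1.
by apply/unitrPr; exists (fcoef g 0); rewrite mulrC.
Qed.

Lemma fps_inv_out : {in [predC fps_unit], fps_inv =1 id}.
Proof. by move=> f; rewrite inE /fps_inv => /negbTE ->. Qed.

HB.instance Definition _ :=
  GRing.ComNzRing_hasMulInverse.Build (fps R) fps_mulVf fps_unitPl fps_inv_out.

End FpsUnit.

(* Words in [k]^n are n-tuples over 'I_k; the element a of 'I_k, with
   0 <= a < k, stands for the letter a + 1 of [k] = {1, ..., k}. *)
Definition letter (k : nat) (a : 'I_k) : nat := a.+1.

Definition odd_up (k n : nat) (w : n.-tuple 'I_k) : bool :=
  [forall i : 'I_n, forall j : 'I_n, (j == i.+1 :> nat) ==>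
     odd (letter (tnth w i)) ==> (letter (tnth w i) < letter (tnth w j))%N].

Definition num_odd_up (k n : nat) : nat := #|[set w : n.-tuple 'I_k | odd_up w]|.

Definition odd_up_gf (k : nat) : fps rat := Fps (fun n => (num_odd_up k n)%:R).

(* Main.v *)
Require Import Defs.
From mathcomp Require Import all_boot all_order all_algebra.
From mathcomp Require Import ring.

Set Implicit Arguments.
Unset Strict Implicit.
Unset Printing Implicit Defensive.

Import GRing.Theory.
Local Open Scope ring_scope.

(**
  Let S_j be the generating function of the odd-up words that are empty or have
  first letter greater than j; thus S_0 = B_k and S_k = 1. Splitting off the
  words whose first letter is j + 1 and deleting that letter gives
  S_j = S_{j+1} + x S_{j+1} if j + 1 is odd and S_j = S_{j+1} + x B_k if j + 1
  is even. With y = 1 + x, induction on j gives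
  B_k (1 + y - y^(floor(j/2) + 1)) = y^(ceil(j/2)) S_j,
  and the theorem is the case j = k.
*)

Lemma fcoefD (R : comNzRingType) (f g : fps R) n :
  fcoef (f + g) n = fcoef f n + fcoef g n.
Proof. by []. Qed.

Lemma fcoefN (R : comNzRingType) (f : fps R) n : fcoef (- f) n = - fcoef f n.
Proof. by []. Qed.

Lemma fcoefM (R : comNzRingType) (f g : fps R) n :
  fcoef (f * g) n = \sum_(i < n.+1) fcoef f i * fcoef g (n - i).
Proof. by []. Qed.

Lemma fcoef1 (R : comNzRingType) n : fcoef (1 : fps R) n = (n == 0%N)%:R.
Proof. by []. Qed.

Lemma fcoef0M (R : comNzRingType) (f g : fps R) :
  fcoef (f * g) 0 = fcoef f 0 * fcoef g 0.
Proof. by rewrite fcoefM big_ord1. Qed.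

Lemma fcoef0X (R : comNzRingType) (f : fps R) m :
  fcoef (f ^+ m) 0 = fcoef f 0 ^+ m.
Proof. by elim: m => // m IHm; rewrite !exprS fcoef0M IHm. Qed.

Lemma fcoefXM (R : comNzRingType) (f : fps R) n :
  fcoef (fpsX R * f) n = if n is m.+1 then fcoef f m else 0.
Proof.
case: n => [|m]; first by rewrite fcoef0M mul0r.
rewrite fcoefM big_ord_recl mul0r add0r big_ord_recl /= mul1r subn1 /=.
by rewrite big1 ?addr0 // => i _; rewrite mul0r.
Qed.

Section OddUp.
Variable k : nat.

Definition odd_up_rel : rel 'I_k := fun a b => odd (letter a) ==> (a < b)%N.

(** In the form [sorted], the condition can be peeled off letter by letter through [path]. *)
Lemma odd_up_sorted n (w : n.-tuple 'I_k) : odd_up w = sorted odd_up_rel w.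
Proof.
case: n w => [|n] w; first by rewrite tuple0; apply/forallP => -[].
have x0 := tnth w ord0.
apply/forallP/(sortedP x0) => [up i|up i].
  rewrite size_tuple => lt_in.
  have /forallP/(_ (Ordinal lt_in)) := up (Ordinal (ltnW lt_in)).
  by rewrite eqxx !(tnth_nth x0).
apply/forallP => j; apply/implyP => /eqP ij; rewrite !(tnth_nth x0) ij.
by apply: up; rewrite size_tuple -ij.
Qed.

(* [k] exceeds every letter code, so that the empty word passes for [j <= k]. *)
Definition odd_up_from (j n : nat) : {set n.-tuple 'I_k} :=
  [set w : n.-tuple 'I_k | odd_up w && (j <= head k (map val w))%N].

Definition odd_up_from_gf (j : nat) : fps rat :=
  Fps (fun n => #|odd_up_from j n|%:R).

Lemma odd_up_from_gf0 : odd_up_from_gf 0 = odd_up_gf k.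
Proof.
apply/fpsP => n /=; congr (_%:R); apply: eq_card => w.
by rewrite !inE leq0n andbT.
Qed.

(** Every first code is below [k], so only the empty word, with default head [k], survives. *)
Lemma odd_up_from_gfk : odd_up_from_gf k = 1.
Proof.
apply/fpsP => -[|n] /=.
  rewrite (_ : odd_up_from k 0 = setT) ?cardsT ?card_tuple //.
  by apply/setP => w; rewrite !inE odd_up_sorted tuple0 /= leqnn.
rewrite (_ : odd_up_from k n.+1 = set0) ?cards0 //.
by apply/setP => w; rewrite !inE; case/tupleP: w => a w /=; rewrite leqNgt ltn_ord andbF.
Qed.

Definition odd_up_after (a : 'I_k) (n : nat) : {set n.-tuple 'I_k} :=
  [set w : n.-tuple 'I_k | path odd_up_rel a w].

(** The first code either exceeds [a] or equals it; words of the second kind arise injectively by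
    prepending [a] to a word that may follow it. *)
Lemma card_odd_up_fromS (a : 'I_k) n :
  #|odd_up_from a n.+1| = (#|odd_up_from a.+1 n.+1| + #|odd_up_after a n|)%N.
Proof.
have consI : injective (fun w : n.-tuple 'I_k => [tuple of a :: w]).
  by move=> u v /(congr1 val)[/val_inj].
rewrite -(card_imset _ consI) -(cardsID (odd_up_from a.+1 n.+1)).
congr (_ + _)%N; apply: eq_card => w.
  rewrite !inE; case/tupleP: w => b w /=; case: (odd_up _) => //=.
  by rewrite andbC; apply/andb_idr/ltnW.
apply/idP/imsetP => [|[{}w + ->]]; last first.
  by rewrite !inE !odd_up_sorted /= ltnn leqnn andbF => ->.
case/tupleP: w => b w; rewrite !inE odd_up_sorted /=.
case up: path => //=; rewrite -leqNgt -eqn_leq => /eqP/val_inj ab; subst b.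
by exists w; rewrite ?inE //; apply: val_inj.
Qed.

(** Codes and letters have opposite parity: an odd code stands for an even letter, which imposes
    nothing on its successor. *)
Lemma odd_up_afterE (a : 'I_k) n :
  odd_up_after a n = odd_up_from (if odd a then 0 else a.+1) n.
Proof.
apply/setP => w; rewrite !inE odd_up_sorted.
case: (tval w) => [|b s] /=; first by case: (odd a); rewrite ?ltn_ord.
by rewrite andbC /odd_up_rel /letter /=; case: (odd a).
Qed.

Lemma odd_up_from_gfS (j : nat) : (j < k)%N ->
  odd_up_from_gf j = odd_up_from_gf j.+1
    + fpsX rat * (if odd j then odd_up_gf k else odd_up_from_gf j.+1).
Proof.
move=> jk; rewrite -odd_up_from_gf0; apply/fpsP => -[|n].
  (* In degree 0 both sides count the empty word, since its default head [k] is at least [j.+1]. *)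
  rewrite fcoefD fcoefXM addr0 /=; congr (_%:R); apply: eq_card => w.
  by rewrite !inE tuple0 /= jk ltnW.
rewrite fcoefD fcoefXM /= (card_odd_up_fromS (Ordinal jk)) odd_up_afterE natrD.
by rewrite /=; case: (odd j).
Qed.

Lemma odd_up_gf_from (j : nat) : (j <= k)%N ->
  odd_up_gf k * (fpsX rat + 2%:R - (fpsX rat + 1) ^+ j./2.+1)
    = (fpsX rat + 1) ^+ uphalf j * odd_up_from_gf j.
Proof.
elim: j => [_|j IHj jk]; first by rewrite odd_up_from_gf0 /=; ring.
have := IHj (ltnW jk); rewrite odd_up_from_gfS // uphalf_half -[j.+1./2]/(uphalf j).
rewrite [uphalf j.+1]/= uphalf_half.
(* The goal and the induction hypothesis have the same difference of sides: for odd [j], the term x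
   y^((j+1)/2) B_k merely moves from right to left. *)
have subE (R : zmodType) (a b c d : R) : a - b = c - d -> c = d -> a = b.
  by move=> eq_sub cd; apply/eqP; rewrite -subr_eq0 eq_sub cd subrr.
by case: (odd j) => /= IH; apply: subE IH; rewrite ?add0n ?add1n !exprS; ring.
Qed.

End OddUp.

(** The constant coefficient is 2 - 1 = 1, so the quotient in the theorem is a genuine one. *)
Lemma odd_up_denominator_unit m :
  fpsX rat + 2%:R - (fpsX rat + 1) ^+ m \is a GRing.unit.
Proof.
rewrite [_ \is a _]/(fcoef _ 0 \is a GRing.unit).
by rewrite !fcoefD fcoefN fcoef0X !fcoefD !fcoef1 /= !add0r expr1n.
Qed.

Theorem theorem2 (k : nat) (hk : (2 <= k)%N) :
  odd_up_gf k =
    (fpsX rat + 1) ^+ ((k + 1) %/ 2)%N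
      / (fpsX rat + 2%:R - (fpsX rat + 1) ^+ ((k + 2) %/ 2)%N).
Proof.
apply: (canRL (mulrK (odd_up_denominator_unit _))).
rewrite !divn2 addn1 addn2 /= odd_up_gf_from //.
by rewrite odd_up_from_gfk mulr1.
Qed.
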